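(* Let $\mathbf{K}$ be a class of finite structures over a finite relational vocabulary, closed under isomorphism, satisfying HP and AP. Then there is a unique (up to isomorphism) countably infinite structure $\mathcal{M}$ such that $Age(\mathcal{M})=\mathbf{K}$ and $\mathcal{M}$ is boundedly homogenizable.
   Context: $Age(\mathcal{M})$ is the class of finite substructures of $\mathcal{M}$ up to isomorphism. HP: every substructure of a member of $\mathbf{K}$ is in $\mathbf{K}$. A structure $\mathcal{A}$ is an amalgamation base for $\mathbf{K}$ if for all $\mathcal{B},\mathcal{C}\in\mathbf{K}$ and embeddings $f:\mathcal{A}\to\mathcal{B}$, $g:\mathcal{A}\to\mathcal{C}$ there are $\mathcal{D}\in\mathbf{K}$ and embeddings $f_0:\mathcal{B}\to\mathcal{D}$, $g_0:\mathcal{C}\to\mathcal{D}$ with $f_0\circ f=g_0\circ g$; AP: every member of $\mathbf{K}$ is an amalgamation base. A structure is homogeneous if every embedding of a finite substructure into it extends to an automorphism. A $V$-structure $\mathcal{M}$ is homogenizable if there are finitely many parameter-free formulas $\varphi_1,\dots,\varphi_n$ such that the expansion of $\mathcal{M}$ by new relation symbols $R_i$ interpreted as $\varphi_i$ is homogeneous. For a tuple $\bar a$, $tp(\bar a)$ is its complete type over $\emptyset$ in $\mathcal{M}$; it is isolated by a quantifier-free formula if some quantifier-free formula true of $\bar a$ implies (in $\mathcal{M}$) every formula of $tp(\bar a)$. $\mathcal{M}$ is boundedly homogenizable if it is homogenizable and for each tuple $\bar a\in M$ there is a tuple $\bar b\in M$ such that $tp(\bar a\bar b)$ is isolated by a quantifier-free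 formula.
   Formalization: K is additionally assumed to have members of arbitrarily large finite size (otherwise no infinite M can have age K, e.g. K empty), and relation symbols are assumed to have positive arity (with nullary symbols K may contain two different empty structures). *)

(* Defs.v *)
From mathcomp Require Import all_boot.
From mathcomp Require Import boolp classical_sets functions cardinality.

Set Implicit Arguments.
Unset Strict Implicit.
Unset Printing Implicit Defensive.

Local Open Scope classical_set_scope.
Local Open Scope card_scope.

Record vocabulary := Vocabulary {
  sym : finType;
  arity : sym -> nat
}.

(* The carrier may be empty, as in Fraisse theory. *)
Record structure (V : vocabulary) := Structure {
  carrier :> Type;
  interp : forall R : sym V, set ((arity R).-tuple carrier)
}.

Section Structures.
Variable V : vocabulary.
Implicit Types A B C D M : structure V.

Definition finite_structure A := finite_set [set: A].
Definition countably_infinite A := [set: A] #= [set: nat].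

Definition embedding A B (f : A -> B) : Prop :=
  injective f /\
  forall (R : sym V) (x : (arity R).-tuple A),
    interp x <-> interp (map_tuple f x).

Definition isomorphism A B (f : A -> B) : Prop := embedding f /\ bijective f.

Definition isomorphic A B : Prop := exists f : A -> B, isomorphism f.

Definition substructure A (S : set A) : structure V :=
  @Structure V S (fun R x => interp (map_tuple val x)).

Definition age M A : Prop :=
  exists S : set M, finite_set S /\ isomorphic A (substructure S).

Definition closed_under_isomorphism (K : structure V -> Prop) : Prop :=
  forall A B, isomorphic A B -> K A -> K B.

Definition HP (K : structure V -> Prop) : Prop :=
  forall A (S : set A), K A -> K (substructure S).

Definition amalgamation_base (K : structure V -> Prop) A : Prop :=
  forall B C (f : A -> B) (g : A -> C),
    K B -> K C -> embedding f -> embedding g ->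
    exists (D : structure V) (f0 : B -> D) (g0 : C -> D),
      [/\ K D, embedding f0, embedding g0 & f0 \o f =1 g0 \o g].

Definition AP (K : structure V -> Prop) : Prop :=
  forall A, K A -> amalgamation_base K A.

Definition homogeneous M : Prop :=
  forall (S : set M) (f : substructure S -> M),
    finite_set S -> embedding f ->
    exists2 g : M -> M, isomorphism g & forall s : S, g (val s) = f s.

(* [formula n] has its free variables among [n] variables, indexed by ['I_n];
   the body of [FAll] has one more, placed at index 0.  The remaining
   connectives and the existential quantifier are classically definable. *)
Inductive formula : nat -> Type :=
| FBot n : formula n
| FEq n (i j : 'I_n) : formula n
| FRel n (R : sym V) (t : (arity R).-tuple 'I_n) : formula n
| FImp n (p q : formula n) : formula n
| FAll n (p : formula n.+1) : formula n.

Fixpoint quantifier_free n (p : formula n) : bool :=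
  match p with
  | FImp _ p q => quantifier_free p && quantifier_free q
  | FAll _ _ => false
  | _ => true
  end.

Fixpoint sat M n (p : formula n) : n.-tuple M -> Prop :=
  match p with
  | FBot _ => fun _ => False
  | FEq _ i j => fun v => tnth v i = tnth v j
  | FRel _ _ t => fun v => interp (map_tuple (tnth v) t)
  | FImp _ p q => fun v => sat p v -> sat q v
  | FAll _ p => fun v => forall a : M, sat p (cons_tuple a v)
  end.

Definition tp M n (a : n.-tuple M) : set (formula n) := [set p | sat p a].

Definition isolated_by_qf M n (a : n.-tuple M) : Prop :=
  exists theta : formula n,
    [/\ quantifier_free theta, sat theta a &
        forall p, tp a p -> forall c : n.-tuple M, sat theta c -> sat p c].

End Structures.

Definition expanded_vocabulary (V : vocabulary) n (k : 'I_n -> nat) :=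
  @Vocabulary (sym V + 'I_n)%type
    (fun s => match s with inl R => arity R | inr i => k i end).

Definition expansion (V : vocabulary) (M : structure V) n (k : 'I_n -> nat)
    (phi : forall i, formula V (k i)) : structure (expanded_vocabulary V k) :=
  @Structure (expanded_vocabulary V k) M
    (fun s => match s with
              | inl R => @interp V M R
              | inr i => @sat V M (k i) (phi i)
              end).

Definition homogenizable (V : vocabulary) (M : structure V) : Prop :=
  exists (n : nat) (k : 'I_n -> nat) (phi : forall i, formula V (k i)),
    homogeneous (expansion M phi).

Definition boundedly_homogenizable (V : vocabulary) (M : structure V) : Prop :=
  homogenizable M /\
  forall n (a : n.-tuple M),
    exists (m : nat) (b : m.-tuple M), isolated_by_qf (cat_tuple a b).

(* Main.v *)
(* Call a structure rich if every partial isomorphism from a member of K into it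
   extends to an embedding. Countable rich structures with age K exist by
   Fraisse's construction and are isomorphic by back and forth; back and forth
   also makes them homogeneous, hence boundedly homogenizable because the
   vocabulary is finite and the atomic diagram of a tuple isolates its type.
   Uniqueness reduces to showing that AP makes every boundedly homogenizable
   structure with age K rich. *)

Require Import Defs.
From mathcomp Require Import all_boot.
From mathcomp Require Import boolp classical_sets functions cardinality.

Local Open Scope classical_set_scope.
Local Open Scope card_scope.

Set Implicit Arguments.
Unset Strict Implicit.

(** * Embeddings and partial isomorphisms *)

Section PartialIsomorphisms.
Variable V : vocabulary.
Implicit Types A B C M N : structure V.

Lemma map_tuple_comp n (T1 T2 T3 : Type) (f : T2 -> T3) (g : T1 -> T2)
  (x : n.-tuple T1) :
  map_tuple f (map_tuple g x) = map_tuple (f \o g) x.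
Proof. by apply: eq_from_tnth => i; rewrite !tnth_map. Qed.

Lemma eq_map_tuple n (T1 T2 : Type) (f g : T1 -> T2) (x : n.-tuple T1) :
  (forall i, f (tnth x i) = g (tnth x i)) -> map_tuple f x = map_tuple g x.
Proof. by move=> fg; apply: eq_from_tnth => i; rewrite !tnth_map. Qed.

Lemma embedding_comp A B C (f : B -> C) (g : A -> B) :
  embedding f -> embedding g -> embedding (f \o g).
Proof.
move=> [fi fr] [gi gr]; split; first exact: inj_comp.
by move=> R x; rewrite gr fr map_tuple_comp.
Qed.

Lemma embedding_id A : embedding (@id A).
Proof.
split=> // R x; suff -> : map_tuple id x = x by [].
by apply: eq_from_tnth => i; rewrite tnth_map.
Qed.

Lemma embedding_val A (S : set A) : @embedding V (substructure S) A val.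
Proof. by split; first exact: val_inj. Qed.

Lemma embedding_corestrict A B (S : set B) (f : A -> substructure S) :
  @embedding V A B (fun a => val (f a)) -> embedding f.
Proof.
move=> [fi fr]; split=> [a b ab|R x]; first by apply: fi; rewrite ab.
by rewrite fr /= map_tuple_comp.
Qed.

Lemma finite_substructure A (S : set A) :
  finite_set S -> finite_structure (substructure S).
Proof. by rewrite /finite_structure /= (eq_finite_set (card_setT S)). Qed.

Lemma isomorphic_range A B (f : A -> B) :
  embedding f -> isomorphic A (substructure (range f)).
Proof.
move=> fe; have mf a : f a \in range f by rewrite in_setE; exists a.
exists (fun a => exist _ (f a) (mf a)); split.
  exact: embedding_corestrict.
have inv (s : substructure (range f)) : exists a, f a = val s.
  by have := valP s; rewrite in_setE => -[a _ <-]; exists a.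
have [g gP] := choice inv.
exists g => [a|s]; last by apply: val_inj => /=.
by apply: fe.1; rewrite gP.
Qed.

Lemma isomorphism_inv A B (f : A -> B) g :
  isomorphism f -> cancel f g -> cancel g f -> embedding g.
Proof.
move=> [[fi fr] _] fK gK; split; first exact: can_inj gK.
move=> R x; rewrite fr map_tuple_comp.
suff -> : map_tuple (f \o g) x = x by [].
by apply: eq_from_tnth => i; rewrite tnth_map /= gK.
Qed.

Lemma isomorphic_sym A B : isomorphic A B -> isomorphic B A.
Proof.
move=> [f fi]; case: (fi) => fe [g fK gK]; exists g; split; last by exists f.
exact: isomorphism_inv fK gK.
Qed.

Lemma age_embedding M A (f : A -> M) :
  finite_structure A -> embedding f -> age M A.
Proof.
move=> fA fe; exists (range f); split; first exact: finite_image.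
exact: isomorphic_range.
Qed.

Lemma embedding_of_age M A : age M A -> exists f : A -> M, embedding f.
Proof.
move=> [S [_ [f [fe _]]]]; exists (val \o f).
exact: embedding_comp (@embedding_val _ _) fe.
Qed.

(* Partial isomorphisms are relations rather than partial maps, so that they
   can be reversed and unions of chains taken. *)
Definition partial_iso A B (P : set (A * B)) : Prop :=
  (forall p q, P p -> P q -> (p.1 = q.1 <-> p.2 = q.2)) /\
  forall (R : sym V) (t : (arity R).-tuple (A * B)), (forall i, P (tnth t i)) ->
    (interp (map_tuple fst t) <-> interp (map_tuple snd t)).

Lemma partial_iso_swap A B (P : set (A * B)) :
  partial_iso P -> @partial_iso B A [set p | P (p.2, p.1)].
Proof.
move=> [Pe Pr]; split=> [p q Pp Pq|R t Pt].
  by have /= [? ?] := Pe _ _ Pp Pq; split.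
have := Pr R (map_tuple (fun p => (p.2, p.1)) t).
rewrite !map_tuple_comp => h; apply: iff_sym; apply: h => i.
by rewrite tnth_map; exact: Pt.
Qed.

Lemma partial_iso_preimage A A' B B' (f : A -> A') (g : B -> B')
  (P : set (A' * B')) :
  embedding f -> embedding g -> partial_iso P ->
  @partial_iso A B [set p | P (f p.1, g p.2)].
Proof.
move=> [fi fr] [gi gr] [Pe Pr]; split=> [p q Pp Pq|R t Pt].
  have /= [h1 h2] := Pe _ _ Pp Pq.
  split=> [/(congr1 f)/h1/gi //|/(congr1 g)/h2/fi //].
have := Pr R (map_tuple (fun p => (f p.1, g p.2)) t).
rewrite fr gr !map_tuple_comp; apply=> i; rewrite tnth_map; exact: Pt.
Qed.

Lemma partial_iso_image A A' B B' (f : A -> A') (g : B -> B')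
  (P : set (A * B)) :
  embedding f -> embedding g -> partial_iso P ->
  @partial_iso A' B' [set (f p.1, g p.2) | p in P].
Proof.
move=> [fi fr] [gi gr] [Pe Pr]; split=> [_ _ [p Pp <-] [q Pq <-]|R t Pt] /=.
  have [h1 h2] := Pe _ _ Pp Pq.
  by split=> [/fi/h1->|/gi/h2->].
have {}Pt i : exists p, P p /\ (f p.1, g p.2) = tnth t i.
  by have [p Pp <-] := Pt i; exists p.
have [u uP] : exists u : (arity R).-tuple (A * B),
    forall i, P (tnth u i) /\ (f (tnth u i).1, g (tnth u i).2) = tnth t i.
  by have [u uP] := choice Pt; exists (mktuple u) => i; rewrite tnth_mktuple.
have -> : map_tuple fst t = map_tuple f (map_tuple fst u).
  by apply: eq_from_tnth => i; rewrite !tnth_map -(uP i).2.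
have -> : map_tuple snd t = map_tuple g (map_tuple snd u).
  by apply: eq_from_tnth => i; rewrite !tnth_map -(uP i).2.
by rewrite -fr -gr; apply: Pr => i; case: (uP i).
Qed.

Lemma partial_iso_graph A B (f : A -> B) :
  embedding f -> @partial_iso A B [set p | f p.1 = p.2].
Proof.
move=> [fi fr]; split=> [p q /= <- <-|R t tf]; first by split=> [->|/fi].
rewrite fr map_tuple_comp (_ : map_tuple (f \o fst) t = map_tuple snd t) //.
by apply: eq_map_tuple => i; apply: tf.
Qed.

Lemma partial_iso_embedding A B (P : set (A * B)) (f : A -> B) :
  partial_iso P -> (forall a, P (a, f a)) -> embedding f.
Proof.
move=> [Pe Pr] Pf; split=> [a b ab|R x]; first by apply/(Pe _ _ (Pf a) (Pf b)).
have := Pr R (map_tuple (fun a => (a, f a)) x).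
rewrite !map_tuple_comp (_ : map_tuple (fst \o _) x = x); last first.
  by apply: eq_from_tnth => i; rewrite tnth_map.
by apply=> i; rewrite tnth_map.
Qed.

(** The first projection is injective on [P], so [P] is no larger than [A]. *)
Lemma partial_iso_finite A B (P : set (A * B)) :
  finite_structure A -> partial_iso P -> finite_set P.
Proof.
move=> fA [Pe _]; have fi : {in P &, injective fst}.
  move=> [a b] [a' b'] /set_mem Pp /set_mem Pq /= aa'.
  by have := (Pe _ _ Pp Pq).1 aa'; rewrite /= => ->; rewrite aa'.
rewrite -(eq_finite_set (inj_card_eq fi)).
exact: sub_finite_set fA.
Qed.

(** A tuple has finitely many entries, so all of them already lie in one member of the chain, the
    one with the largest index chosen. *)
Lemma partial_iso_union A B (P : nat -> set (A * B)) :
  (forall i j, i <= j -> P i `<=` P j) -> (forall i, partial_iso (P i)) ->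
  partial_iso (\bigcup_i P i).
Proof.
move=> Pm Pi; split=> [p q [i _ Pp] [j _ Pq]|R t].
  apply: (Pi (maxn i j)).1; first exact: Pm (leq_maxl _ _) _ Pp.
  exact: Pm (leq_maxr _ _) _ Pq.
move=> Pt; have {}Pt i : exists k, P k (tnth t i) by have [k _] := Pt i; exists k.
have [k kP] := choice Pt.
apply: (Pi (\max_i k i)).2 => i.
by apply: Pm (kP i); apply: leq_bigmax.
Qed.

(** Both projections are injective on [P], so choice functions for the two totality assumptions
    invert each other. *)
Lemma partial_iso_isomorphic A B (P : set (A * B)) :
  partial_iso P -> (forall a, exists b, P (a, b)) ->
  (forall b, exists a, P (a, b)) ->
  exists2 f : A -> B, isomorphism f & forall p, P p -> f p.1 = p.2.
Proof.
move=> Pi /choice[f fP] /choice[g gP]; exists f; last first.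
  by move=> [a b] Pab; apply: (Pi.1 _ _ (fP a) Pab).1.
split; first exact: partial_iso_embedding Pi fP.
exists g => [a|b].
  exact: (Pi.1 _ _ (gP (f a)) (fP a)).2.
exact: (Pi.1 _ _ (fP (g b)) (gP b)).1.
Qed.

(** For a nullary symbol the empty tuple would vacuously have its entries in [set0], forcing [A] and
    [B] to agree on that symbol; positive arities exclude this. *)
Lemma partial_iso_set0 A B :
  (forall R : sym V, 0 < arity R) -> partial_iso (set0 : set (A * B)).
Proof. by move=> a0; split=> // R t /(_ (Ordinal (a0 R))). Qed.

(** [P] is the graph of an embedding of the substructure induced on its domain. *)
Lemma homogeneous_partial_iso M (P : set (M * M)) :
  homogeneous M -> finite_set P -> partial_iso P ->
  exists2 g : M -> M, isomorphism g & forall p, P p -> g p.1 = p.2.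
Proof.
move=> hM fP Pi; pose S := fst @` P.
have Sf (s : substructure S) : exists y, P (val s, y).
  by have := valP s; rewrite in_setE => -[[x y] Pxy <-]; exists y.
have [f fP'] := choice Sf.
have fe : embedding f.
  apply: partial_iso_embedding fP'.
  exact: (partial_iso_preimage (@embedding_val M S) (@embedding_id M) Pi).
have [|g gi gf] := hM S f _ fe; first exact: finite_image.
exists g => // -[x y] Pxy.
have xS : x \in S by rewrite in_setE; exists (x, y).
rewrite -[(x, y).1]/(val (exist _ x xS : substructure S)) gf.
exact: (Pi.1 _ _ (fP' (exist _ x xS)) Pxy).1.
Qed.

End PartialIsomorphisms.

(* Rasiowa-Sikorski for countably many dense sets [D i]. *)
Lemma dense_chain (T : Type) (I : T -> Prop) (le : T -> T -> Prop)
  (D : nat -> T -> Prop) (p0 : T) :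
  (forall p, le p p) -> (forall q p r, le p q -> le q r -> le p r) ->
  I p0 -> (forall i p, I p -> exists q, [/\ I q, le p q & D i q]) ->
  exists s : nat -> T, [/\ s 0 = p0, forall i, I (s i),
    forall i j, i <= j -> le (s i) (s j) & forall i, D i (s i.+1)].
Proof.
move=> le_refl le_trans Ip0 dense.
have /choice[F FP] (ip : nat * {p | I p}) :
    exists q : {p | I p}, le (sval ip.2) (sval q) /\ D ip.1 (sval q).
  case: ip => i [p Ip]; have [q [Iq pq Dq]] := dense i p Ip.
  by exists (exist _ q Iq).
pose s := fix s i := if i is j.+1 then F (j, s j) else exist _ p0 Ip0.
exists (fun i => sval (s i)); split=> // [i|i j|i]; first exact: svalP (s i).
  elim: j => [|j IH]; first by rewrite leqn0 => /eqP->.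
  rewrite leq_eqVlt => /predU1P[->//|]; rewrite ltnS => /IH ij.
  exact: le_trans ij (FP (j, s j)).1.
exact: (FP (i, s i)).2.
Qed.

(** * Richness and back and forth *)

Section Rich.
Variables (V : vocabulary) (K : structure V -> Prop).
Implicit Types A B C M N : structure V.
Hypothesis K_iso : closed_under_isomorphism K.
Hypothesis K_HP : HP K.
Hypothesis K_AP : AP K.

(* The extension property that characterises the Fraisse limit. *)
Definition rich N := forall B (P : set (B * N)), K B -> partial_iso P ->
  exists2 h : B -> N, embedding h & forall p, P p -> h p.1 = p.2.

Lemma K_embedding A B (f : A -> B) : embedding f -> K B -> K A.
Proof.
by move=> /isomorphic_range/isomorphic_sym AB /(K_HP (range f)); apply: K_iso.
Qed.

(** The forth step: richness is applied to the finite substructure of [M] on the domain of [P]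
    together with [a], and [Q] is the graph of the resulting embedding. *)
Lemma rich_extend M N (P : set (M * N)) (a : M) :
  (forall A, age M A -> K A) -> rich N -> finite_set P -> partial_iso P ->
  exists Q : set (M * N), [/\ finite_set Q, partial_iso Q, P `<=` Q
    & exists b, Q (a, b)].
Proof.
move=> MK rN fP Pi; pose S := a |` fst @` P.
have fS : finite_set S by rewrite finite_setU; split=> //; exact: finite_image.
have KS : K (substructure S).
  by apply: MK; exists S; split=> //; exists id; split; [exact: embedding_id|exists id].
have vS := @embedding_val V M S.
have [h he hP] := rN _ _ KS (partial_iso_preimage vS (@embedding_id _ N) Pi).
have inS x : S x -> x \in S by rewrite in_setE.
exists [set (val p.1, p.2) | p in [set p | h p.1 = p.2]]; split.
- apply/finite_image/partial_iso_finite/partial_iso_graph => //.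
  exact: finite_substructure.
- exact: partial_iso_image vS (@embedding_id _ N) (partial_iso_graph he).
- move=> [x y] Pxy; have Sx : S x by right; exists (x, y).
  exists (exist _ x (inS _ Sx), y) => //=.
  exact: (hP (exist _ x (inS _ Sx), y)).
- have Sa : S a by left.
  pose sa : substructure S := exist _ a (inS _ Sa).
  by exists (h sa), (sa, h sa).
Qed.

Lemma countably_infinite_enum M :
  countably_infinite M -> exists e : nat -> M, forall x, exists i, e i = x.
Proof.
move=> /card_esym/card_bijP[f [g _ gK]].
exists (fun i => val (f (exist _ i (in_setT i)))) => x.
exists (val (g (exist _ x (in_setT x)))).
by rewrite (_ : exist _ _ _ = g (exist _ x (in_setT x))) ?gK //; apply: val_inj.
Qed.

(** The chain consists of finite partial isomorphisms ordered by inclusion. The [i]-th requirement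
    puts [eM i] in the domain and [eN i] in the range, so the union is total on both sides. *)
Lemma back_and_forth M N (P : set (M * N)) :
  countably_infinite M -> countably_infinite N ->
  (forall A, age M A -> K A) -> (forall A, age N A -> K A) ->
  rich M -> rich N -> finite_set P -> partial_iso P ->
  exists2 f : M -> N, isomorphism f & forall p, P p -> f p.1 = p.2.
Proof.
move=> /countably_infinite_enum[eM eMP] /countably_infinite_enum[eN eNP].
move=> MK NK rM rN fP Pi.
have [|||i Q [fQ Qi]|s [s0 sI sm sD]] := @dense_chain (set (M * N))
  (fun Q => finite_set Q /\ partial_iso Q) (fun Q Q' => Q `<=` Q')
  (fun i Q => (exists b, Q (eM i, b)) /\ exists a, Q (a, eN i)) P.
- by move=> Q x.
- by move=> Q Q1 Q2 h1 h2; exact: subset_trans h1 h2.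
- by [].
- have [Q1 [fQ1 Q1i QQ1 [b Q1b]]] := rich_extend (eM i) MK rN fQ Qi.
  (* The back step is the forth step for the reversed relation. *)
  have fQ1' : finite_set [set p : N * M | Q1 (p.2, p.1)].
    apply: (sub_finite_set _ (finite_image (fun p => (p.2, p.1)) fQ1)).
    by move=> [y x] Qxy; exists (x, y).
  have [Q2 [fQ2 Q2i Q12 [a Q2a]]] :=
    rich_extend (eN i) NK rM fQ1' (partial_iso_swap Q1i).
  exists [set p | Q2 (p.2, p.1)]; split.
  + split; last exact: partial_iso_swap.
    apply: (sub_finite_set _ (finite_image (fun p => (p.2, p.1)) fQ2)).
    by move=> [x y] Qxy; exists (y, x).
  + by move=> [x y] /QQ1 Qxy; apply: Q12.
  + by split; [exists b; apply: Q12|exists a].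
have := @partial_iso_isomorphic V M N (\bigcup_i s i).
case=> [|a|b|f fi fs].
- exact: partial_iso_union sm (fun i => (sI i).2).
- have [i <-] := eMP a; have [[b sb] _] := sD i; exists b.
  by exists i.+1.
- have [i <-] := eNP b; have [_ [a sa]] := sD i; exists a.
  by exists i.+1.
- by exists f => // p Pp; apply: fs; exists 0 => //; rewrite s0.
Qed.

(** The amalgamation base is the substructure of [B] on the domain of [P], embedded in [B] by
    inclusion and in [C] by [P]. *)
Lemma amalgamation B C (P : set (B * C)) : K B -> K C -> partial_iso P ->
  exists (D : structure V) (f : B -> D) (g : C -> D),
    [/\ K D, embedding f, embedding g & forall p, P p -> f p.1 = g p.2].
Proof.
move=> KB KC Pi; pose S := fst @` P.
have Sg (s : substructure S) : exists y, P (val s, y).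
  by have := valP s; rewrite in_setE => -[[x y] Pxy <-]; exists y.
have [g gP] := choice Sg.
have vS := @embedding_val V B S.
have ge : embedding g.
  apply: partial_iso_embedding gP.
  exact: (partial_iso_preimage vS (@embedding_id _ C) Pi).
have [D [f0 [g0 [KD f0e g0e fg]]]] := K_AP (K_HP S KB) KB KC vS ge.
exists D, f0, g0; split=> // -[x y] Pxy.
have xS : x \in S by rewrite in_setE; exists (x, y).
have := fg (exist _ x xS); rewrite /= => ->; congr g0.
exact: (Pi.1 _ _ (gP (exist _ x xS)) Pxy).1.
Qed.

End Rich.

(** * Types and automorphisms *)

Section Formulas.
Variable V : vocabulary.
Implicit Types M N : structure V.

(** Index 0 is the variable bound by [FAll] and stays fixed, which avoids capture. *)
Definition lift_renaming n m (r : 'I_n -> 'I_m) (i : 'I_n.+1) : 'I_m.+1 :=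
  if unlift ord0 i is Some j then lift ord0 (r j) else ord0.

Fixpoint rename n (p : formula V n) : forall m, ('I_n -> 'I_m) -> formula V m :=
  match p with
  | FBot _ => fun m _ => FBot V m
  | FEq _ i j => fun m r => FEq V (r i) (r j)
  | FRel _ R t => fun m r => FRel (map_tuple r t)
  | FImp _ p q => fun m r => FImp (rename p r) (rename q r)
  | FAll _ p => fun m r => FAll (rename p (lift_renaming r))
  end.

Lemma sat_rename M n (p : formula V n) m (r : 'I_n -> 'I_m) (v : m.-tuple M) :
  sat (rename p r) v <-> sat p [tuple tnth v (r i) | i < n].
Proof.
elim: p m r v => {n} [n|n i j|n R t|n p IHp q IHq|n p IHp] m r v //=.
- by rewrite !tnth_mktuple.
- rewrite map_tuple_comp (eq_map_tuple (g := tnth [tuple tnth v (r i) | i < n])) //.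
  by move=> i; rewrite tnth_mktuple.
- by split=> h /IHp/h/IHq.
- suff e a : [tuple tnth (cons_tuple a v) (lift_renaming r i) | i < n.+1] =
             cons_tuple a [tuple tnth v (r i) | i < n].
    by split=> h a; have := h a; rewrite IHp e.
  apply: eq_from_tnth => i; rewrite tnth_mktuple /lift_renaming.
  by case: unliftP => [j|] ->; rewrite ?tnth0 ?tnthS ?tnth_mktuple.
Qed.

Lemma sat_isomorphism M N (f : M -> N) n (p : formula V n) (v : n.-tuple M) :
  isomorphism f -> sat p v <-> sat p (map_tuple f v).
Proof.
move=> [[fi fr] [g fK gK]].
elim: p v => {n} [n|n i j|n R t|n p IHp q IHq|n p IHp] v //=.
- by rewrite !tnth_map; split=> [->|/fi].
- rewrite fr map_tuple_comp (eq_map_tuple (g := tnth (map_tuple f v))) //.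
  by move=> i; rewrite tnth_map.
- by split=> h /IHp/h/IHq.
- have e a : map_tuple f (cons_tuple a v) = cons_tuple (f a) (map_tuple f v).
    exact: val_inj.
  split=> h a; last by apply/IHp; rewrite e; exact: h.
  (* Surjectivity handles the quantifier: every element [a] of [N] is [f (g a)]. *)
  by rewrite -(gK a) -e; apply/IHp/h.
Qed.

Lemma sat_qf_embedding M N (f : M -> N) n (p : formula V n) (v : n.-tuple M) :
  embedding f -> quantifier_free p -> sat p v <-> sat p (map_tuple f v).
Proof.
move=> [fi fr]; elim: p v => {n} [n|n i j|n R t|n p IHp q IHq|//] v //=.
- by rewrite !tnth_map; split=> [->|/fi].
- rewrite fr map_tuple_comp (eq_map_tuple (g := tnth (map_tuple f v))) //.
  by move=> i; rewrite tnth_map.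
- by move=> /andP[qp qq]; split=> h /(IHp _ qp)/h/(IHq _ qq).
Qed.

Lemma finite_tuple_range (T : Type) n (a : n.-tuple T) :
  finite_set [set x | exists i, tnth a i = x].
Proof.
apply: (sub_finite_set _ (finite_image (tnth a) (@finite_finset 'I_n setT))).
by move=> x [i <-]; exists i.
Qed.

Lemma finite_tuple_cover (T : Type) (S : set T) : finite_set S ->
  exists n (a : n.-tuple T), forall x, S x -> exists i, tnth a i = x.
Proof.
move=> /finite_setP[n /card_esym/card_bijP[f [g _ gK]]]; exists n.
have iI (i : 'I_n) : (i : nat) \in `I_n by rewrite in_setE /=.
exists [tuple val (f (exist _ (i : nat) (iI i))) | i < n] => x /mem_set xS.
have := valP (g (exist _ x xS)); rewrite in_setE /= => lt.
exists (Ordinal lt); rewrite tnth_mktuple.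
by rewrite (_ : exist _ _ _ = g (exist _ x xS)) ?gK //; apply: val_inj.
Qed.

Definition tuple_graph (T U : Type) n (a : n.-tuple T) (b : n.-tuple U) :
  set (T * U) := [set p | exists i, (tnth a i, tnth b i) = p].

Lemma finite_tuple_graph (T U : Type) n (a : n.-tuple T) (b : n.-tuple U) :
  finite_set (tuple_graph a b).
Proof.
have := finite_tuple_range [tuple (tnth a i, tnth b i) | i < n].
apply: sub_finite_set => p [i <-]; exists i; exact: tnth_mktuple.
Qed.

(** Complete types are maximal: if [p] fails at [a], its negation lies in [tp a], hence in
    [tp b]. *)
Lemma tp_sub_eq M n (a b : n.-tuple M) :
  tp a `<=` tp b -> forall p, sat p a <-> sat p b.
Proof.
move=> ab p; split=> [/ab //|pb].
by apply: contrapT => /(ab (FImp p (FBot V n))); apply.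
Qed.

(** Equality atoms make the graph single-valued both ways and relation atoms handle the symbols of
    [V]. For a new symbol, its defining formula is renamed along the positions [r] of the
    arguments. *)
Lemma tp_sub_partial_iso M n (a b : n.-tuple M) m k
  (phi : forall i : 'I_m, formula V (k i)) :
  tp a `<=` tp b ->
  @partial_iso _ (expansion M phi) (expansion M phi) (tuple_graph a b).
Proof.
move=> /tp_sub_eq ab; split=> [_ _ [i <-] [j <-]|R t Pt].
  exact: (ab (FEq V i j)).
have [r rP] := choice Pt.
have e1 : map_tuple fst t = [tuple tnth a (r i) | i < arity R].
  by apply: eq_from_tnth => i; rewrite tnth_map tnth_mktuple -rP.
have e2 : map_tuple snd t = [tuple tnth b (r i) | i < arity R].
  by apply: eq_from_tnth => i; rewrite tnth_map tnth_mktuple -rP.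
rewrite e1 e2; case: R {t Pt e1 e2 rP} r => [R|i] r /=.
- have := ab (FRel [tuple r i | i < arity R]).
  by rewrite /= !map_tuple_comp; congr iff; congr interp; apply: eq_from_tnth => i;
    rewrite !tnth_map.
- by rewrite -!sat_rename.
Qed.

Lemma expansion_isomorphism M m k (phi : forall i : 'I_m, formula V (k i))
  (g : expansion M phi -> expansion M phi) :
  isomorphism g -> @isomorphism V M M g.
Proof. by move=> [[gi gr] gb]; split=> //; split=> // R; apply: (gr (inl R)). Qed.

(* Complete a finite tuple in the range of the partial isomorphism to a tuple
   [c] isolated by a quantifier-free formula, amalgamate and embed in [M]: the
   image [d] of [c] has the same type as [c], so an automorphism of [M] moves
   [d] back to [c]. *)
Lemma boundedly_homogenizable_rich (K : structure V -> Prop) M :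
  (forall A, K A -> finite_structure A) -> HP K -> AP K ->
  (forall A, age M A <-> K A) -> boundedly_homogenizable M -> rich K M.
Proof.
move=> K_finite K_HP K_AP MK [[n0 [k [phi hom]]] bd] B P KB Pi.
have fP := partial_iso_finite (K_finite _ KB) Pi.
have [n [a aP]] := finite_tuple_cover (finite_image snd fP).
have [m [b [theta [qf sc iso]]]] := bd n a.
set c := cat_tuple a b in sc iso.
pose S := [set x | exists i, tnth c i = x].
have KS : K (substructure S).
  apply/MK; exists S; split; first exact: finite_tuple_range.
  by exists id; split; [exact: embedding_id|exists id].
have vS := @embedding_val V M S.
have Qi := partial_iso_preimage (@embedding_id _ B) vS Pi.
have [D [f [g [KD fe ge fg]]]] := amalgamation K_HP K_AP KB KS Qi.
have [e ee] : exists e : D -> M, embedding e by apply/embedding_of_age/MK.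
have cS i : tnth c i \in S by rewrite in_setE; exists i.
pose c' : (n + m).-tuple (substructure S) :=
  [tuple exist _ (tnth c i) (cS i) | i < n + m].
have cE : map_tuple val c' = c.
  by apply: eq_from_tnth => i; rewrite tnth_map tnth_mktuple.
pose d := map_tuple (e \o g) c'.
(* Being quantifier-free, [theta] passes from [M] down to the substructure on [S] and then up along
   [e \o g]. *)
have sd : sat theta d.
  apply/(sat_qf_embedding _ (embedding_comp ee ge) qf).
  by apply/(sat_qf_embedding _ vS qf); rewrite cE.
have dc : tp d `<=` tp c.
  have cd : tp c `<=` tp d by move=> p pc; exact: iso.
  by move=> p; have := tp_sub_eq cd p; case.
(* Equality of types preserves the new relations too, so homogeneity of the expansion supplies [s];
   it is also an automorphism of [M]. *)
have [s si sP] := homogeneous_partial_iso hom (finite_tuple_graph d c)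
  (tp_sub_partial_iso phi dc).
exists (s \o e \o f).
  apply: embedding_comp fe; apply: embedding_comp ee.
  exact: (expansion_isomorphism si).1.
move=> [x y] Pxy /=.
have [i yi] : exists i, tnth c i = y.
  have [|i <-] := aP y; first by exists (x, y).
  by exists (lshift m i); rewrite tnth_lshift.
have -> : f x = g (tnth c' i).
  by apply: (fg (x, tnth c' i)); rewrite /= tnth_mktuple /= yi.
have := sP (tnth d i, tnth c i); rewrite /= yi => <-; last by exists i; rewrite yi.
congr s; exact: (esym (tnth_map (e \o g) c' i)).
Qed.

(** * Atomic diagrams as quantifier-free formulas *)

Definition FAnd n (p q : formula V n) : formula V n :=
  FImp (FImp p (FImp q (FBot V n))) (FBot V n).

Lemma sat_FAnd M n (p q : formula V n) (a : n.-tuple M) :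
  sat (FAnd p q) a <-> sat p a /\ sat q a.
Proof.
split=> [h|[sp sq] h]; last exact: h.
by split; apply: contrapT => hn; apply: h => // ? ?; apply: hn.
Qed.

Definition FBigAnd n (I : finType) (F : I -> formula V n) : formula V n :=
  foldr (fun i => FAnd (F i)) (FImp (FBot V n) (FBot V n)) (enum I).

Lemma sat_FBigAnd M n (I : finType) (F : I -> formula V n) (a : n.-tuple M) :
  sat (FBigAnd F) a <-> forall i, sat (F i) a.
Proof.
suff h s : sat (foldr (fun i => FAnd (F i)) (FImp (FBot V n) (FBot V n)) s) a <->
    forall i, i \in s -> sat (F i) a.
  rewrite h; split=> Fa i; last by move=> _; apply: Fa.
  by apply: Fa; rewrite mem_enum.
elim: s => [|i s IH]; first by split=> // _ [].
rewrite [foldr _ _ _]/= sat_FAnd IH; split=> [[ai as_] j|h].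
  by rewrite inE => /predU1P[->|/as_].
by split=> [|j js]; apply: h; rewrite inE ?eqxx ?js ?orbT.
Qed.

(** The index type is finite because [sym V] is, so all atomic formulas in [n] variables can enter
    one finite conjunction. *)
Definition atom n (u : 'I_n * 'I_n + {R : sym V & (arity R).-tuple 'I_n}) :
  formula V n :=
  match u with
  | inl u => FEq V u.1 u.2
  | inr u => FRel (tagged u)
  end.

Definition diagram M n (a : n.-tuple M) : formula V n :=
  FBigAnd (fun u => if `[< sat (atom u) a >] then atom u
                     else FImp (atom u) (FBot V n)).

Lemma quantifier_free_diagram M n (a : n.-tuple M) :
  quantifier_free (diagram a).
Proof.
rewrite /diagram /FBigAnd; elim: (enum _) => //= u s ->.
by rewrite !andbT; case: asboolP; case: u.
Qed.

Lemma sat_diagram M N n (a : n.-tuple M) (c : n.-tuple N) :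
  sat (diagram a) c <-> forall u, sat (@atom n u) a <-> sat (@atom n u) c.
Proof.
rewrite sat_FBigAnd; split=> h u; have := h u; case: asboolP => ua /=; tauto.
Qed.

Lemma diagram_partial_iso M N n (a : n.-tuple M) (c : n.-tuple N) :
  sat (diagram a) c -> partial_iso (tuple_graph a c).
Proof.
move=> /sat_diagram ac; split=> [_ _ [i <-] [j <-]|R t Pt].
  exact: (ac (inl (i, j))).
have [r rP] := choice Pt.
have := ac (inr (Tagged _ [tuple r i | i < arity R])).
rewrite /= !map_tuple_comp; congr iff; congr interp; apply: eq_from_tnth => i;
  by rewrite !tnth_map tnth_ord_tuple -rP.
Qed.

End Formulas.
Lemma rich_boundedly_homogenizable (V : vocabulary) (K : structure V -> Prop)
  (M : structure V) :
  countably_infinite M ->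
  (forall A, age M A -> K A) -> rich K M -> boundedly_homogenizable M.
Proof.
move=> cM MK rM; have bf := back_and_forth cM cM MK MK rM rM.
split.
  (* [M] is already homogeneous, so no symbol is added; the arities and formulas are placeholders
     over the empty type ['I_0]. *)
  exists 0, (fun=> 0), (fun=> FBot V 0) => S f fS [fi fr].
  have fe : @embedding V (@substructure V M S) M f.
    by split=> // R x; apply: (fr (inl R)).
  have [||g [[gi gr] gb] gf] := bf [set (val p.1, p.2) | p in
      [set p : @substructure V M S * M | f p.1 = p.2]].
  - apply/finite_image/partial_iso_finite/partial_iso_graph => //.
    exact: finite_substructure.
  - apply: partial_iso_image (@embedding_id _ M) (partial_iso_graph fe).
    exact: (@embedding_val V M S).
  exists g; first by split=> //; split=> // -[R|[//]]; exact: gr.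
  by move=> s; apply: (gf (val s, f s)); exists (s, f s).
move=> n a; exists 0, [tuple]; set c := cat_tuple _ _.
exists (diagram c); split.
- exact: quantifier_free_diagram.
- by apply/sat_diagram.
(* A tuple [d] satisfying the diagram of [c] is the image of [c] under an automorphism, which
   preserves every formula. *)
- move=> p pc d /diagram_partial_iso Pi.
  have [g gi gP] := bf _ (finite_tuple_graph c d) Pi.
  rewrite (_ : d = map_tuple g c); first exact: (sat_isomorphism p c gi).1.
  apply: eq_from_tnth => i; rewrite tnth_map.
  by have /= -> := gP (tnth c i, tnth d i); last exists i.
Qed.

(** * Construction of the Fraisse limit *)

Section Limit.
Variables (V : vocabulary) (K : structure V -> Prop).
Hypothesis arity_gt0 : forall R : sym V, 0 < arity R.
Hypothesis K_finite : forall A, K A -> finite_structure A.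
Hypothesis K_unbounded : forall n : nat, exists2 A, K A & `I_n #<= [set: A].
Hypothesis K_iso : closed_under_isomorphism K.
Hypothesis K_HP : HP K.
Hypothesis K_AP : AP K.

(* A condition [(n, G)] stands for the structure that [G] induces on [`I_n];
   the part of [G] outside [`I_n] is irrelevant. *)
Definition condition := (nat * forall R : sym V, set ((arity R).-tuple nat))%type.

Definition below (q : condition) n (x : n.-tuple nat) :=
  forall i, tnth x i < q.1.
Definition whole (q : condition) : structure V := Structure q.2.
Definition part (q : condition) : structure V := @substructure V (whole q) `I_q.1.

Definition extends (p q : condition) : Prop := p.1 <= q.1 /\
  forall R (x : (arity R).-tuple nat), below p x -> (p.2 R x <-> q.2 R x).

Lemma extends_refl p : extends p p. Proof. by []. Qed.

Lemma extends_trans q p r : extends p q -> extends q r -> extends p r.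
Proof.
move=> [pq hpq] [qr hqr]; split=> [|R x px]; first exact: leq_trans qr.
by rewrite hpq // hqr // => i; apply: leq_trans (px i) pq.
Qed.

(* The elements outside the image of [f] are numbered from [n] on. *)
Lemma numbering (D : Type) n (f : nat -> D -> Prop) : finite_set [set: D] ->
  (forall i, i < n -> exists d, f i d) ->
  (forall i j d e, i < n -> j < n -> f i d -> f j e -> (i = j <-> d = e)) ->
  exists m (c : D -> nat), [/\ n <= m, injective c, range c = `I_m
    & forall i d, i < n -> f i d -> c d = i].
Proof.
move=> fD fex finj; pose rest := [set d | forall i, i < n -> ~ f i d].
have /finite_setP[k /card_bijP[u [v uK vK]]] : finite_set rest.
  exact: sub_finite_set fD.
have pos d : exists j, (exists i, [/\ i < n, f i d & j = i]) \/
    exists r : rest, val r = d /\ j = n + val (u r).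
  have [[i [lt fid]]|no] := pselect (exists i, i < n /\ f i d).
    by exists i; left; exists i.
  have dr : d \in rest by rewrite in_setE => i lt fid; apply: no; exists i.
  by exists (n + val (u (exist _ d dr))); right; exists (exist _ d dr).
have [c cP] := choice pos; exists (n + k), c; split.
- exact: leq_addr.
- move=> d e; case: (cP d) (cP e) => [[i [li fi ->]]|[r [<- ->]]]
    [[j [lj fj ->]]|[s [<- ->]]].
  + by move/(finj _ _ _ _ li lj fi fj).
  + by move=> ij; move: li; rewrite ij ltnNge leq_addr.
  + by move=> ij; move: lj; rewrite -ij ltnNge leq_addr.
  + by move/addnI/val_inj/(can_inj uK)->.
- apply/seteqP; split=> [_ [d _ <-]|i] /=.
    case: (cP d) => [[j [lj _ ->]]|[r [_ ->]]]; first exact: ltn_addr.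
    by rewrite ltn_add2l; have := valP (u r); rewrite in_setE.
  move=> lt; have [lin|nin] := ltnP i n.
    have [d fd] := fex i lin; exists d => //.
    case: (cP d) => [[j [lj fj ->]]|[r [rd _]]].
      by apply/(finj _ _ _ _ lj lin fj fd).
    by have := valP r; rewrite in_setE => /(_ i lin); rewrite rd.
  have ik : (i - n) \in `I_k by rewrite in_setE /= ltn_subLR.
  pose r := v (exist _ (i - n) ik); exists (val r) => //.
  case: (cP (val r)) => [[j [lj fj _]]|[s [sr ->]]].
    by have := valP r; rewrite in_setE => /(_ j lj).
  have -> : s = r by exact: val_inj.
  by rewrite vK /= subnKC.
- move=> i d li fid; case: (cP d) => [[j [lj fj ->]]|[r [rd _]]].
    by apply/(finj _ _ _ _ lj li fj fid).
  by have := valP r; rewrite in_setE => /(_ i li); rewrite rd.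
Qed.

Lemma below_part q n (x : n.-tuple nat) : below q x ->
  exists y : n.-tuple (part q), map_tuple val y = x.
Proof.
move=> qx; have xi i : tnth x i \in `I_q.1 by rewrite in_setE; exact: qx.
exists [tuple exist _ (tnth x i) (xi i) | i < n].
by apply: eq_from_tnth => i; rewrite tnth_map tnth_mktuple.
Qed.

(** Amalgamate [B] with [part p] over [P], then number the amalgam so that the elements of [part p]
    keep their numbers. *)
Lemma extend_amalgam p (B : structure V) (P : set (B * whole p)) : K (part p) -> K B ->
  partial_iso P -> (forall u, P u -> u.2 < p.1) ->
  exists q, [/\ K (part q), extends p q &
    exists h : B -> whole q, [/\ embedding h, forall b, h b < q.1
      & forall u, P u -> h u.1 = u.2]].
Proof.
move=> Kp KB Pi Pp.
have vp := @embedding_val V (whole p) `I_p.1.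
have Qi := partial_iso_preimage (@embedding_id _ B) vp Pi.
have [D [f [g [KD fe ge fg]]]] := amalgamation K_HP K_AP KB Kp Qi.
have inp i : i < p.1 -> i \in `I_p.1 by rewrite in_setE.
have [|i j d e li lj [s <- <-] [t <- <-]|m [c [pm ci cr cg]]] :=
  @numbering D p.1 (fun i d => exists2 s, val s = i & g s = d) (K_finite KD).
- by move=> i li; exists (g (exist _ i (inp i li))), (exist _ i (inp i li)).
- by split=> [/val_inj->|/ge.1->].
(* The relations of [D] are transported along the numbering [c]. *)
pose q : condition :=
  (m, fun R => [set y | exists2 x : (arity R).-tuple D, map_tuple c x = y & interp x]).
have ce : @embedding V D (whole q) c.
  split=> // R x; split=> [xR|[y /= yx yR]]; first by exists x.
  suff <- : y = x by [].
  apply: eq_from_tnth => i; apply: ci.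
  by have := congr1 (fun z => tnth z i) yx; rewrite !tnth_map.
exists q; split.
- by apply: K_iso KD; rewrite /part -cr; exact: isomorphic_range.
- split=> // R x px; have [y yx] := below_part px.
  have cgy : map_tuple c (map_tuple g y) = x.
    rewrite -yx map_tuple_comp; apply: eq_map_tuple => i.
    apply: cg; last by exists (tnth y i).
    by have := valP (tnth y i); rewrite in_setE.
  have -> : p.2 R x <-> @interp V (part p) R y by rewrite -yx.
  by rewrite ge.2 ce.2 cgy.
- exists (c \o f); split; first exact: embedding_comp.
    move=> b; have : `I_m (c (f b)) by rewrite -cr; exists (f b).
    by [].
  move=> [b i] Pbi; have li := Pp _ Pbi.
  rewrite /= (fg (b, exist _ i (inp i li))) //; apply: cg => //.
  by exists (exist _ i (inp i li)).
Qed.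

(* A task [(l, T, Q)] asks for an embedding of the structure listed by [l] and
   restricted to [T] that extends the finite map with graph [Q]. *)
Definition task :=
  (seq {R : sym V & (arity R).-tuple nat} * seq nat * seq (nat * nat))%type.

Definition task_structure (u : task) : structure V :=
  @Structure V nat (fun R => [set x | Tagged _ x \in u.1.1]).

(** The bound on [u.2] stands outside the implication: it is what lets a partial isomorphism into
    the later union be read at stage [q], so that the last premise can be checked. *)
Definition solved (u : task) (q : condition) : Prop :=
  (forall z, z \in u.2 -> z.2 < q.1) /\ (
  K (@substructure V (task_structure u) [set` u.1.2]) ->
  (forall z, z \in u.2 -> z.1 \in u.1.2) ->
  @partial_iso V (task_structure u) (whole q) [set` u.2] ->
  exists W : set (nat * nat), [/\ [set` u.2] `<=` W,
    forall i, i \in u.1.2 -> exists j, W (i, j), forall z, W z -> z.2 < q.1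
    & @partial_iso V (task_structure u) (whole q) W]).

(** Amalgamating over the empty relation with a large member of [K] makes room. *)
Lemma extend_size p n : K (part p) -> exists q, [/\ K (part q), extends p q & n <= q.1].
Proof.
move=> Kp; have [A KA nA] := K_unbounded n.
have [//|q [Kq pq [h [[hi _] hq _]]]] :=
  extend_amalgam Kp KA (partial_iso_set0 A (whole p) arity_gt0).
exists q; split=> //; rewrite -card_le_II; apply: card_le_trans nA _.
rewrite -(card_le_eql (inj_card_eq (f := h) _)); last by move=> ? ? _ _; apply: hi.
by apply: subset_card_le => _ [a _ <-]; apply: hq.
Qed.

Lemma extend_solved p u : K (part p) -> 
  exists q, [/\ K (part q), extends p q & solved u q].
Proof.
move=> Kp; have [q [Kq pq bq]] := extend_size (\max_(z <- u.2) z.2).+1 Kp.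
have uq z : z \in u.2 -> z.2 < q.1.
  by move=> zu; apply: leq_trans bq; rewrite ltnS; apply: leq_bigmax_seq.
(* If a premise fails at [q], then [q] itself solves [u]; so otherwise all premises hold and
   amalgamation applies. *)
have [sq|nsq] := pselect (solved u q); first by exists q.
have {nsq} : K (@substructure V (task_structure u) [set` u.1.2]) /\
    (forall z, z \in u.2 -> z.1 \in u.1.2) /\
    @partial_iso V (task_structure u) (whole q) [set` u.2].
  by apply: contrapT => no; apply: nsq; split=> // h1 h2 h3; case: no.
move=> [Ku [uT Ui]].
have vT := @embedding_val V (task_structure u) [set` u.1.2].
have [|r [Kr qr [h [he hr hP]]]] :=
  extend_amalgam Kq Ku (partial_iso_preimage vT (@embedding_id _ (whole q)) Ui).
  by move=> [s i] /= /uq.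
exists r; split=> //; first exact: extends_trans qr.
split=> [z /uq zq|_ _ _]; first exact: leq_trans zq qr.1.
exists [set (val z.1, z.2) | z in [set z | h z.1 = z.2]]; split.
- move=> [i j] uij; have iT : i \in [set` u.1.2] by rewrite in_setE; exact: (uT _ uij).
  by exists (exist _ i iT, j) => //; apply: (hP (exist _ i iT, j)).
- move=> i iu; have iT : i \in [set` u.1.2] by rewrite in_setE.
  by exists (h (exist _ i iT)), (exist _ i iT, h (exist _ i iT)).
- by move=> _ [z /= <- <-]; apply: hr.
- exact: partial_iso_image vT (@embedding_id _ (whole r)) (partial_iso_graph he).
Qed.

Lemma K_empty : K (part (0, fun=> set0)).
Proof.
have [A KA _] := K_unbounded 0.
have none (s : part (0, fun=> set0)) : False by case: s => i; rewrite in_setE.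
apply: (@K_embedding V K K_iso K_HP _ A (fun s => False_rect _ (none s))) => //.
split=> [s|R x]; first by case: (none s).
by case: (none (tnth x (Ordinal (arity_gt0 R)))).
Qed.

(** Tasks are countable, so requirement [i] can ask for size at least [i] together with a solution
    of the task coded by [i]. *)
Lemma generic_chain : exists s : nat -> condition, [/\ forall i, K (part (s i)),
  forall i j, i <= j -> extends (s i) (s j), forall i, i <= (s i.+1).1
  & forall u, exists i, solved u (s i)].
Proof.
have [p||i p Kp|s [_ sK sm sD]] := @dense_chain _ (fun p => K (part p)) extends
  (fun i q => i <= q.1 /\ forall u : task, unpickle i = Some u -> solved u q)
  _ _ _ K_empty.
- exact: extends_refl.
- by move=> q p r; exact: extends_trans.
- have [q [Kq pq iq]] := extend_size i Kp.
  case: (unpickle i : option task) => [u|]; last by exists q; split.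
  have [r [Kr qr sr]] := extend_solved u Kq.
  exists r; split=> //; first exact: extends_trans qr.
  by split=> [|_ [<-]//]; exact: leq_trans iq qr.1.
exists s; split=> // [i|u]; first by case: (sD i).
by exists (pickle u).+1; apply: (sD (pickle u)).2; rewrite pickleK.
Qed.

(** * The union of a generic chain *)

Section Union.
Variable s : nat -> condition.
Hypothesis sK : forall i, K (part (s i)).
Hypothesis s_extends : forall i j, i <= j -> extends (s i) (s j).
Hypothesis s_size : forall i, i <= (s i.+1).1.
Hypothesis s_solved : forall u, exists i, solved u (s i).

Definition union : structure V :=
  @Structure V nat (fun R => [set x | exists i, below (s i) x /\ (s i).2 R x]).

(** Any two stages containing [x] agree on it, since both agree with the later one. *)
Lemma interp_union i R (x : (arity R).-tuple nat) : below (s i) x ->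
  (@interp V union R x <-> @interp V (whole (s i)) R x).
Proof.
move=> bi; split=> [[j [bj sj]]|si]; last by exists i.
apply/((s_extends (leq_maxl i j)).2 _ _ bi).
exact/((s_extends (leq_maxr i j)).2 _ _ bj).
Qed.

Lemma union_bounded_embedding (A : structure V) (f : A -> union) i :
  embedding f -> (forall a, f a < (s i).1) -> K A.
Proof.
move=> [fi fr] fb.
have fI a : f a \in `I_(s i).1 by rewrite in_setE; exact: fb.
apply: (@K_embedding V K K_iso K_HP _ (part (s i))
  (fun a => exist _ (f a) (fI a))) => //.
apply: embedding_corestrict; split=> // R x.
by rewrite fr (@interp_union i) // => k; rewrite tnth_map.
Qed.

Lemma partial_iso_union_whole (A : structure V) (W : set (A * nat)) i :
  (forall z, W z -> z.2 < (s i).1) ->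
  @partial_iso V A union W <-> @partial_iso V A (whole (s i)) W.
Proof.
move=> Wi; have h R (t : (arity R).-tuple (A * nat)) : (forall k, W (tnth t k)) ->
    (@interp V union R (map_tuple snd t) <->
     @interp V (whole (s i)) R (map_tuple snd t)).
  by move=> Wt; apply: interp_union => k; rewrite tnth_map; exact: Wi.
by split=> -[We Wr]; split=> // R t Wt; rewrite Wr // h.
Qed.

(** The finite data of [B] and [P] are copied to numbers as a task; the stage that solves it yields
    a relation [W], which is pulled back along the numbering. *)
Lemma rich_union : rich K union.
Proof.
move=> B P KB Pi.
(* With no number prescribed, [c] is a bijection of [B] onto the numbers below [m]. *)
have [//|//|m [c [_ ci cr _]]] := @numbering B 0 (fun _ _ => False) (K_finite KB).
have cm b : c b < m by have : `I_m (c b) by rewrite -cr; exists b.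
pose L := [set z : {R : sym V & (arity R).-tuple nat} |
  exists2 x : (arity (tag z)).-tuple B, map_tuple c x = tagged z & interp x].
have /finite_seqP[l Ll] : finite_set L.
  apply: (sub_finite_set _ (finite_image
    (fun u : {R : sym V & (arity R).-tuple 'I_m} =>
       Tagged (fun R => (arity R).-tuple nat) (map_tuple val (tagged u)))
    (@finite_finset _ setT))).
  move=> [R y] [x /= <- _].
  exists (Tagged (fun R => (arity R).-tuple 'I_m)
    (map_tuple (fun b => Ordinal (cm b)) x)) => //=.
  by congr Tagged; rewrite map_tuple_comp.
have /finite_seqP[Q PQ] := finite_image (fun p => (c p.1, p.2))
  (partial_iso_finite (K_finite KB) Pi).
pose u : task := (l, iota 0 m, Q).
have ce : @embedding V B (task_structure u) c.
  have lL z : L z <-> z \in l by rewrite Ll.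
  split=> // R x; apply: iff_trans (lL (Tagged _ (map_tuple c x))).
  split=> [xR|[y /= yx yR]]; first by exists x.
  suff <- : y = x by [].
  apply: eq_from_tnth => i; apply: ci.
  by have := congr1 (fun z => tnth z i) yx; rewrite !tnth_map.
have Qi : @partial_iso V (task_structure u) union [set` Q].
  rewrite -PQ; exact: partial_iso_image ce (@embedding_id _ union) Pi.
have [i [Qb si]] := s_solved u.
have KT : K (@substructure V (task_structure u) [set` u.1.2]).
  apply: K_iso KB; rewrite (_ : [set` u.1.2] = range c); first exact: isomorphic_range.
  by rewrite cr; apply/seteqP; split=> k; rewrite /= mem_iota.
have QT z : z \in u.2 -> z.1 \in u.1.2.
  have : [set` Q] `<=` [set z | z.1 < m] by rewrite -PQ => _ [p _ <-]; exact: cm.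
  by move=> /(_ z) h /h; rewrite mem_iota.
(* The values of [Q] lie below the size of stage [i], where stage and union have the same relations,
   so [Qi] passes to the stage. *)
have [W [QW Wex Wb Wi]]
  := si KT QT ((@partial_iso_union_whole (task_structure u) _ _ Qb).1 Qi).
have {}Wi := (@partial_iso_union_whole (task_structure u) _ _ Wb).2 Wi.
have Pi' := partial_iso_preimage ce (@embedding_id _ union) Wi.
have Wc b : exists j, W (c b, j) by apply: Wex; rewrite mem_iota cm.
have [h hW] := choice Wc; exists h; first exact: partial_iso_embedding Pi' hW.
move=> [b j] Pbj; apply: (Wi.1 _ _ (hW b) (_ : W (c b, j))).1 => //.
by apply: QW; rewrite -PQ; exists (b, j).
Qed.

Lemma age_union A : age union A <-> K A.
Proof.
split=> [[S [/finite_seqP[l Sl] [f [fe _]]]]|KA]; last first.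
  have [h he _] := rich_union KA (@partial_iso_set0 _ A union arity_gt0).
  exact: age_embedding (K_finite KA) he.
(* One successor makes the bound strict; the other is the shift in [s_size], which bounds the size
   of stage [i.+1] by [i] from below. *)
apply: (@union_bounded_embedding A (val \o f) (\max_(x <- l) x).+2).
  exact: embedding_comp (@embedding_val _ _ _) fe.
move=> a; apply: leq_trans (s_size _); rewrite ltnS /=.
have : S (val (f a)) by have := valP (f a); rewrite in_setE.
have lS x : S x -> x <= \max_(y <- l) y.
  by rewrite Sl => xl; apply: (@leq_bigmax_seq _ _ _ id).
exact: lS.
Qed.

End Union.

Lemma fraisse_limit : exists M : structure V,
  [/\ countably_infinite M, forall A, age M A <-> K A & rich K M].
Proof.
have [s [sK sm ss sS]] := generic_chain; exists (union s); split.
- exact: card_eqxx.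
- exact: age_union.
- exact: rich_union.
Qed.

End Limit.

Theorem theorem1p2 (V : vocabulary) (K : structure V -> Prop)
  (arity_gt0 : forall R : sym V, 0 < arity R)
  (K_finite : forall A, K A -> finite_structure A)
  (K_unbounded : forall n : nat, exists2 A, K A & `I_n #<= [set: A])
  (K_iso : closed_under_isomorphism K)
  (K_HP : HP K)
  (K_AP : AP K) :
  exists M : structure V,
    [/\ countably_infinite M, forall A, age M A <-> K A & boundedly_homogenizable M] /\
    forall N : structure V,
      [/\ countably_infinite N, forall A, age N A <-> K A & boundedly_homogenizable N] ->
      isomorphic M N.
Proof.
have [M [cM MK rM]] :=
  fraisse_limit arity_gt0 K_finite K_unbounded K_iso K_HP K_AP.
have MK' A : age M A -> K A by move/MK.
exists M; split.
  by split=> //; exact: rich_boundedly_homogenizable rM.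
move=> N [cN NK bN].
have rN := boundedly_homogenizable_rich K_finite K_HP K_AP NK bN.
have NK' A : age N A -> K A by move/NK.
(* Both structures are rich, so back and forth starts from the empty partial isomorphism. *)
have [f fi _] := back_and_forth cM cN MK' NK' rM rN (finite_set0 _)
  (@partial_iso_set0 _ M N arity_gt0).
by exists f.
Qed.
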